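(* Let $0<p<1$, let $\{X_n,\ n\ge1\}$ be the steps of the elephant random walk that remembers only the first two steps and the most recent step, with $P(X_1=1)=p=1-P(X_1=-1)$, and let $S_n=\sum_{k=1}^n X_k$. Then, as $n\to\infty$, $\dfrac{S_n}{n}$ converges in distribution to a random variable $S$ that equals $\dfrac{2p-1}{2-p}$ with probability $p^2$, $0$ with probability $1-p$, and $-\dfrac{2p-1}{2-p}$ with probability $p(1-p)$. Moreover, $E(S_n/n)^r\to E(S^r)$ for all $r>0$, since $|S_n/n|\le 1$ for all $n$.
   Context: Elephant random walk remembering only the first two steps and the most recent step: $X_2=X_1$ with probability $p$ and $X_2=-X_1$ with probability $1-p$; for $n=2$ choose $K$ uniformly on $\{1,2\}$, and for every $n\ge3$ choose $K$ uniformly on $\{1,2,n\}$; then set $X_{n+1}=X_K$ with probability $p$ and $X_{n+1}=-X_K$ with probability $1-p$. All index choices and sign choices are mutually independent and independent of $X_1$. The notation $E(S_n/n)^r$ means the expectation of the $r$-th power of $S_n/n$. *)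

(* Defs.v *)
From HB Require Import structures.
From mathcomp Require Import all_boot all_order all_algebra finmap.
From mathcomp Require Import all_classical all_reals all_analysis.
From mathcomp Require Import measurable_realfun.

Set Implicit Arguments.
Unset Strict Implicit.
Unset Printing Implicit Defensive.

Import Order.TTheory GRing.Theory Num.Theory.
Import numFieldNormedType.Exports.

Local Open Scope classical_set_scope.
Local Open Scope ring_scope.

Definition mutually_independent d (T : measurableType d) (R : realType)
    (P : probability T R) (I : choiceType) (F : I -> set_system T) : Prop :=
  forall (J : {fset I}) (A : I -> set T),
    (forall i, i \in J -> F i (A i)) ->
    P (\bigcap_(i in [set` J]) A i) = (\prod_(i <- J) P (A i))%E.

Definition sigma_RV d d' (T : measurableType d) (T' : measurableType d')
    (R : realType) (P : probability T R) (f : {RV P >-> T'}) : set_system T :=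
  preimage_set_system setT f measurable.

(* For duplicate-free [s].  The values of [f] outside [s] then form a null
   event, as the masses of the points of [s] add up to 1. *)
Definition uniform_on d (T : measurableType d) (R : realType)
    (P : probability T R) (f : {RV P >-> nat}) (s : seq nat) : Prop :=
  forall k, k \in s -> P (f @^-1` [set k]) = ((size s)%:R^-1)%:E.

Section ElephantRandomWalk.
Context d (T : measurableType d) (R : realType) (P : probability T R).

(* [X n] is the n-th step (n >= 1), [K n] the time remembered at time n
   (n >= 2), and [B n] says whether the remembered step is repeated (true) or
   reversed (false) at time n (n >= 1).  Other indices are meaningless. *)

Definition erw_sources (X : nat -> {RV P >-> R}) (K : nat -> {RV P >-> nat})
    (B : nat -> {RV P >-> bool}) (i : option (nat + nat)) : set_system T :=
  match i with
  | None => sigma_RV (X 1%N)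
  | Some (inl n) => sigma_RV (K n.+2)
  | Some (inr n) => sigma_RV (B n.+1)
  end.

Record is_erw_12n (p : R) (X : nat -> {RV P >-> R})
    (K : nat -> {RV P >-> nat}) (B : nat -> {RV P >-> bool}) : Prop := {
  erw_init_pos : P (X 1%N @^-1` [set 1]) = p%:E;
  erw_init_neg : P (X 1%N @^-1` [set -1]) = (1 - p)%:E;
  erw_index2 : uniform_on (K 2%N) [:: 1; 2]%N;
  erw_index : forall n, (3 <= n)%N -> uniform_on (K n) [:: 1; 2; n]%N;
  erw_sign : forall n, (1 <= n)%N -> P (B n @^-1` [set true]) = p%:E;
  erw_indep : mutually_independent P (erw_sources X K B);
  erw_step2 : forall w, X 2%N w = if B 1%N w then X 1%N w else - X 1%N w;
  erw_step : forall n w, (2 <= n)%N ->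
    X n.+1 w = if B n w then X (K n w) w else - X (K n w) w
}.

(* S_n / n *)
Definition erw_mean (X : nat -> {RV P >-> R}) (n : nat) : T -> R :=
  fun w => (\sum_(1 <= k < n.+1) X k w) / n%:R.

Lemma measurable_erw_mean (X : nat -> {RV P >-> R}) (n : nat) :
  measurable_fun setT (erw_mean X n).
Proof.
apply: measurable_funM => //.
by apply: measurable_sum => k; exact: measurable_funPT.
Qed.

HB.instance Definition _ (X : nat -> {RV P >-> R}) (n : nat) :=
  isMeasurableFun.Build _ _ _ _ (erw_mean X n) (measurable_erw_mean X n).

End ElephantRandomWalk.

Definition cvg_in_distribution (R : realType)
    d (T : measurableType d) (P : probability T R) (Y : nat -> {RV P >-> R})
    d' (T' : measurableType d') (P' : probability T' R) (Z : {RV P' >-> R}) :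
    Prop :=
  forall x : R, {for x, continuous (cdf Z)} ->
    cdf (Y n) x @[n --> \oo] --> cdf Z x.
Arguments cvg_in_distribution {R d T} P Y {d' T'} P' Z.

Definition erw_limit_value (R : realType) (p : R) : R := (2 * p - 1) / (2 - p).

(* For p = 1/2 the three values coincide, so that "Z = a with probability q"
   cannot be read as P (Z = a) = q; the law is given as a sum of Dirac
   masses. *)
Definition has_erw_limit_law (R : realType) (p : R)
    d (T : measurableType d) (P : probability T R) (Z : {RV P >-> R}) : Prop :=
  forall A : set R, measurable A ->
    distribution P Z A =
      ((p ^+ 2)%:E * \d_(erw_limit_value p) A + (1 - p)%:E * \d_(0%R : R) A
       + (p * (1 - p))%:E * \d_(- erw_limit_value p)%R A)%E.
Arguments has_erw_limit_law {R} p {d T} P Z.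

(* Real powers of possibly negative numbers.  [powR] is not meaningful on
   negative arguments; for x < 0 any real-valued convention gives x ^ r the
   value |x|^r or -|x|^r, i.e. one of the following two (which agree for
   x >= 0). *)
Definition even_powR (R : realType) (x r : R) : R := `|x| `^ r.
Definition odd_powR (R : realType) (x r : R) : R := Num.sg x * `|x| `^ r.

(* Main.v *)
(** The first two steps are remembered forever.  With a = (2p-1)/3, the drift
    of the walk from time 3 on is E[X_(n+1) | past] = a (X_1 + X_2 + X_n), whose
    fixed point is S = (2p-1)/(2-p) * (X_1 + X_2)/2, a variable on the original
    probability space with the required law.  The variables
    M_n = (1 - a) (S_n - n S) + a (X_n - S) have the bounded uncorrelated
    increments X_(n+1) - a (X_1 + X_2 + X_n), so that E M_n^2 = O(n) and
    E (S_n/n - S)^2 = O(1/n).  Since S has only three values, this gives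
    E f(S_n/n) -> E f(S) as soon as f is measurable, bounded on [-1, 1] and
    continuous at these values.  The moments and the distribution function
    are of this form: every value of S has positive mass, so that a continuity
    point x of the distribution function is none of them, and the indicator of
    ]-oo, x] is continuous at each. *)

Require Import Defs.
From HB Require Import structures.
From mathcomp Require Import all_boot all_order all_algebra finmap.
From mathcomp Require Import all_classical all_reals all_analysis.
From mathcomp Require Import measurable_realfun.
From mathcomp Require Import ring lra.

Set Implicit Arguments.
Unset Strict Implicit.
Unset Printing Implicit Defensive.

Import Order.TTheory GRing.Theory Num.Theory.
Import numFieldNormedType.Exports.
Local Open Scope classical_set_scope.
Local Open Scope ring_scope.

(** * Bounded measurable functions *)

Section BoundedMeasurable.
Context d (T : measurableType d) (R : realType) (P : probability T R).
Implicit Types f g : T -> R.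

(** All variables of the proof are bounded. This class is closed under the ring operations and lies
    in L^1 of a probability, which makes the real-valued integral linear and monotone on it. *)
Definition bounded_mfun f :=
  measurable_fun [set: T] f /\ exists C, forall w, `|f w| <= C.

Lemma bounded_mfun_integrable f : bounded_mfun f ->
  P.-integrable setT (EFin \o f).
Proof.
move=> [mf [C fC]]; apply: measurable_bounded_integrable => //.
  exact: fin_num_fun_lty.
exists C; split; first exact: num_real.
by move=> x Cx w _ /=; exact: le_trans (fC w) (ltW Cx).
Qed.

Lemma bounded_mfun_cst (c : R) : bounded_mfun (fun=> c).
Proof. by split => //; exists `|c|. Qed.

Lemma bounded_mfunD f g : bounded_mfun f -> bounded_mfun g ->
  bounded_mfun (fun w => f w + g w).
Proof.
move=> [mf [C fC]] [mg [C' gC]]; split; first exact: measurable_funD.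
by exists (C + C') => w; rewrite (le_trans (ler_normD _ _))// lerD.
Qed.

Lemma bounded_mfunM f g : bounded_mfun f -> bounded_mfun g ->
  bounded_mfun (fun w => f w * g w).
Proof.
move=> [mf [C fC]] [mg [C' gC]]; split; first exact: measurable_funM.
by exists (C * C') => w; rewrite normrM ler_pM.
Qed.

Lemma bounded_mfunZ c f : bounded_mfun f -> bounded_mfun (fun w => c * f w).
Proof. exact/bounded_mfunM/bounded_mfun_cst. Qed.

Lemma bounded_mfunX f n : bounded_mfun f -> bounded_mfun (fun w => f w ^+ n).
Proof.
move=> bf; elim: n => [|n IHn].
  by under eq_fun do rewrite expr0; exact: bounded_mfun_cst.
by under eq_fun do rewrite exprS; exact: bounded_mfunM.
Qed.

Lemma bounded_mfunB f g : bounded_mfun f -> bounded_mfun g ->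
  bounded_mfun (fun w => f w - g w).
Proof.
move=> bf bg; under eq_fun do rewrite -mulN1r.
exact/bounded_mfunD/bounded_mfunZ.
Qed.

Lemma bounded_mfun_norm f : bounded_mfun f -> bounded_mfun (fun w => `|f w|).
Proof.
move=> [mf [C fC]]; split; first exact: measurableT_comp.
by exists C => w; rewrite normr_id.
Qed.

Lemma bounded_mfun_indic (A : set T) : measurable A ->
  bounded_mfun (\1_A : T -> R).
Proof.
move=> mA; split; first exact: measurable_indic.
by exists 1 => w; rewrite indicE ger0_norm// lern1 leq_b1.
Qed.

Lemma Rintegral_probability_cst (c : R) : \int[P]_w c = c.
Proof. by rewrite Rintegral_cst// [fine _]/(fine (P setT)) probability_setT mulr1. Qed.

Lemma bounded_RintegralD f g : bounded_mfun f -> bounded_mfun g ->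
  \int[P]_w (f w + g w) = \int[P]_w f w + \int[P]_w g w.
Proof. by move=> bf bg; rewrite RintegralD//; exact: bounded_mfun_integrable. Qed.

Lemma bounded_RintegralB f g : bounded_mfun f -> bounded_mfun g ->
  \int[P]_w (f w - g w) = \int[P]_w f w - \int[P]_w g w.
Proof. by move=> bf bg; rewrite RintegralB//; exact: bounded_mfun_integrable. Qed.

Lemma bounded_RintegralZ c f : bounded_mfun f ->
  \int[P]_w (c * f w) = c * \int[P]_w f w.
Proof. by move=> bf; rewrite RintegralZl//; exact: bounded_mfun_integrable. Qed.

Lemma bounded_le_Rintegral f g : bounded_mfun f -> bounded_mfun g ->
  (forall w, f w <= g w) -> \int[P]_w f w <= \int[P]_w g w.
Proof.
by move=> bf bg fg; apply: le_Rintegral => //; exact: bounded_mfun_integrable.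
Qed.

Lemma bounded_le_norm_Rintegral f : bounded_mfun f ->
  `|\int[P]_w f w| <= \int[P]_w `|f w|.
Proof. by move=> bf; rewrite le_normr_Rintegral//; exact: bounded_mfun_integrable. Qed.

Lemma Rintegral_indic (A : set T) : measurable A ->
  \int[P]_w (\1_A w : R) = fine (P A).
Proof. by move=> mA; rewrite /Rintegral integral_indic// setIT. Qed.

Lemma expectation_Rintegral f : bounded_mfun f ->
  'E_P[f]%E = (\int[P]_w f w)%:E.
Proof.
move=> bf; rewrite unlock /Rintegral fineK//.
by apply: integrable_fin_num => //; exact: bounded_mfun_integrable.
Qed.

End BoundedMeasurable.

(** * Expectation and independence *)

Section Cylinders.
Context d (T : measurableType d) (R : realType) (P : probability T R).
Context (I : choiceType) (F : I -> set_system T).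
Hypothesis measurableF : forall i, F i `<=` measurable.
Hypothesis FT : forall i, F i setT.
Hypothesis FI : forall i, setI_closed (F i).
Hypothesis indepF : mutually_independent P F.
Implicit Types (U V : set I) (A C : set T) (f g : T -> R).

(** The pi-system that generates the joint sigma-algebra of the sources in [U]. *)
Definition cylinder U A := exists (J : {fset I}) (E : I -> set T),
  [/\ [set` J] `<=` U, forall i, F i (E i) & A = \bigcap_(i in [set` J]) E i].

Lemma cylinder_measurable U A : cylinder U A -> measurable A.
Proof.
move=> [J [E [_ FE ->]]]; apply: fin_bigcap_measurable => // i _.
exact: measurableF.
Qed.

Lemma cylinderT U : cylinder U setT.
Proof.
exists fset0, (fun=> setT); split => //.
by apply/seteqP; split => // w _ i /=; rewrite in_fset0.
Qed.

Lemma cylinder1 i A : F i A -> cylinder [set i] A.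
Proof.
move=> FA; exists [fset i]%fset, (fun j => if j == i then A else setT); split.
- by move=> j /=; rewrite in_fset1 => /eqP.
- by move=> j; case: eqP => [->|_].
- by apply/seteqP; split => [w Aw j _|w /(_ i)] /=;
    [case: ifP|rewrite in_fset1 eqxx; exact].
Qed.

Lemma subset_cylinder U V A : U `<=` V -> cylinder U A -> cylinder V A.
Proof.
move=> sI [J [E [JI FE ->]]]; exists J, E; split=> //.
exact: subset_trans sI.
Qed.

(** Padding with [setT] puts both intersections over the common index set, the form to which mutual
    independence applies. *)
Lemma cylinderIE J J' (E E' : I -> set T) :
  (\bigcap_(i in [set` J]) E i) `&` (\bigcap_(i in [set` J']) E' i) =
  \bigcap_(i in [set` (J `|` J')%fset])
    ((if i \in J then E i else setT) `&` (if i \in J' then E' i else setT)).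
Proof.
apply/seteqP; split => [w [JE JE'] i _|w JE].
  by split; case: ifPn => // ?; [exact: JE|exact: JE'].
by split => i /= iJ; have := JE i; rewrite /= inE iJ ?orbT => /(_ isT)[].
Qed.

Lemma cylinderI U A C : cylinder U A -> cylinder U C -> cylinder U (A `&` C).
Proof.
move=> [J [E [JI FE ->]]] [J' [E' [JI' FE' ->]]]; rewrite cylinderIE.
exists (J `|` J')%fset; eexists; split; last reflexivity.
  by move=> i /=; rewrite inE => /orP[/JI|/JI'].
by move=> i; apply: FI; case: ifP.
Qed.

(** Mutual independence is applied to [J], to [J'] and to their union. Disjointness splits the
    product over the union into the two others. *)
Lemma cylinder_indep U V A C : U `&` V = set0 ->
  cylinder U A -> cylinder V C -> P (A `&` C) = (P A * P C)%E.
Proof.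
move=> UV [J [E [JI FE ->]]] [J' [E' [JI' FE' ->]]]; rewrite cylinderIE.
have JJ' i : i \in J -> i \in J' -> False.
  by move=> /JI ? /JI' ?; suff: (U `&` V) i by rewrite UV.
rewrite !indepF//; last by move=> i _; apply: FI; case: ifP.
rewrite (big_fsetID _ (mem J)) /=.
have -> : [fset x in (J `|` J')%fset | x \in J]%fset = J.
  by apply/fsetP => i; rewrite !inE /=; case: (i \in J); rewrite ?andbF.
have -> : [fset x in (J `|` J')%fset | x \notin J]%fset = J'.
  apply/fsetP => i; rewrite !inE /=; have := JJ' i.
  by case: (i \in J); case: (i \in J') => //= /(_ isT isT).
congr (_ * _)%E; rewrite big_seq [RHS]big_seq; apply: eq_bigr => i iJ.
  rewrite iJ; case: ifPn => [/(JJ' _ iJ)//|_]; by rewrite setIT.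
rewrite iJ; case: ifPn => [/JJ' /(_ iJ)//|_]; by rewrite setTI.
Qed.

(** Linear combinations of cylinder indicators form an algebra that contains every step of the walk.
    Independence thus passes from events to functions by linearity alone, with no monotone class
    argument. *)
Inductive cylinder_span U : (T -> R) -> Prop :=
| cylinder_span_indic A : cylinder U A -> cylinder_span U \1_A
| cylinder_span_linear c f g : cylinder_span U f -> cylinder_span U g ->
    cylinder_span U (fun w => c * f w + g w).

Lemma cylinder_span_bounded U f : cylinder_span U f -> bounded_mfun f.
Proof.
elim=> [A /cylinder_measurable|c {}f g _ bf _ bg]; first exact: bounded_mfun_indic.
exact/bounded_mfunD/bg/bounded_mfunZ.
Qed.

Lemma subset_cylinder_span U V f : U `<=` V ->
  cylinder_span U f -> cylinder_span V f.
Proof.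
move=> sI; elim=> [A AI|c {}f g _ IHf _ IHg]; last exact: cylinder_span_linear.
exact/cylinder_span_indic/(subset_cylinder sI).
Qed.

Lemma cylinder_span0 U : cylinder_span U (fun=> 0).
Proof.
have sT := cylinder_span_indic (cylinderT U).
(* The zero function has no constructor of its own and is obtained as -1 + 1. *)
rewrite (_ : (fun=> 0) = (fun w => -1 * \1_setT w + \1_setT w)).
  exact: cylinder_span_linear.
by apply/funext => w; rewrite mulN1r addNr.
Qed.

Lemma cylinder_spanD U f g : cylinder_span U f -> cylinder_span U g ->
  cylinder_span U (fun w => f w + g w).
Proof.
move=> sf sg; under eq_fun do rewrite -(mul1r (f _)).
exact: cylinder_span_linear.
Qed.

Lemma cylinder_spanZ U c f : cylinder_span U f ->
  cylinder_span U (fun w => c * f w).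
Proof.
move=> sf; under eq_fun do rewrite -(addr0 (c * f _)).
exact/cylinder_span_linear/cylinder_span0.
Qed.

Lemma cylinder_spanB U f g : cylinder_span U f -> cylinder_span U g ->
  cylinder_span U (fun w => f w - g w).
Proof.
move=> sf sg; under eq_fun do rewrite -mulN1r.
exact/cylinder_spanD/cylinder_spanZ.
Qed.

Lemma cylinder_span_cst U c : cylinder_span U (fun=> c).
Proof.
rewrite (_ : (fun=> c) = (fun w => c * \1_setT w)).
  exact/cylinder_spanZ/cylinder_span_indic/cylinderT.
by apply/funext => w; rewrite indicT mulr1.
Qed.

(** By bilinearity it suffices to multiply two indicators, and cylinders are stable under
    intersection. *)
Lemma cylinder_spanM U f g : cylinder_span U f -> cylinder_span U g ->
  cylinder_span U (fun w => f w * g w).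
Proof.
move=> sf sg; elim: sf => [A cA|c {}f f' _ IHf _ IHf'].
  elim: sg => [C cC|c {}g g' _ IHg _ IHg'].
    under eq_fun do rewrite -[\1_A _ * _]/((\1_A \* \1_C) _).
    by rewrite -indicI; exact/cylinder_span_indic/cylinderI.
  by under eq_fun do rewrite mulrDr mulrCA; exact: cylinder_span_linear.
by under eq_fun do rewrite mulrDl -mulrA; exact: cylinder_span_linear.
Qed.

(** Both sides are bilinear in [f] and [g], so that two inductions reduce the claim to
    [cylinder_indep]. *)
Lemma cylinder_span_indep U V f g : U `&` V = set0 ->
  cylinder_span U f -> cylinder_span V g ->
  \int[P]_w (f w * g w) = (\int[P]_w f w) * (\int[P]_w g w).
Proof.
move=> UV sf sg; elim: sf => [A cA|c {}f f' sf IHf sf' IHf'].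
  have mA := cylinder_measurable cA.
  elim: sg => [C cC|c {}g g' sg IHg sg' IHg'].
    have mC := cylinder_measurable cC.
    rewrite (_ : (fun w => \1_A w * \1_C w) = \1_(A `&` C)); last by rewrite indicI.
    rewrite !Rintegral_indic//; last exact: measurableI.
    by rewrite (cylinder_indep UV)// fineM ?fin_num_measure.
  have bg := cylinder_span_bounded sg; have bg' := cylinder_span_bounded sg'.
  have bA := bounded_mfun_indic R mA.
  under eq_Rintegral do rewrite mulrDr mulrCA.
  rewrite !bounded_RintegralD// ?bounded_RintegralZ// ?IHg ?IHg' ?mulrDr 1?mulrCA//;
  by [exact: bounded_mfunM|exact: bounded_mfunZ|exact/bounded_mfunZ/bounded_mfunM].
have bf := cylinder_span_bounded sf; have bf' := cylinder_span_bounded sf'.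
have bg := cylinder_span_bounded sg.
under eq_Rintegral do rewrite mulrDl -mulrA.
rewrite !bounded_RintegralD// ?bounded_RintegralZ// ?IHf ?IHf' ?mulrDl ?mulrA//;
by [exact: bounded_mfunM|exact: bounded_mfunZ|exact/bounded_mfunZ/bounded_mfunM].
Qed.

End Cylinders.

(** * Convergence to a finitely-valued limit *)

(** Chebyshev's argument in pointwise form: where |Z_n - S| < D, the values of [f] differ by at most
    e/2; elsewhere they differ by at most 2, which is below 2 (Z_n - S)^2 / D^2. *)
Lemma cvg_Rintegral_discrete_limit d (T : measurableType d) (R : realType)
    (P : probability T R) (Z : nat -> T -> R) (S : T -> R) (s : seq R)
    (f : R -> R) :
  (forall n, measurable_fun setT (Z n)) -> measurable_fun setT S ->
  (forall n w, `|Z n w| <= 1) -> (forall w, `|S w| <= 1) ->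
  (forall w, S w \in s) ->
  \int[P]_w (Z n w - S w) ^+ 2 @[n --> \oo] --> 0 ->
  measurable_fun setT f -> (forall x, `|x| <= 1 -> `|f x| <= 1) ->
  (forall a, a \in s -> {for a, continuous f}) ->
  \int[P]_w f (Z n w) @[n --> \oo] --> \int[P]_w f (S w).
Proof.
move=> mZ mS Z1 S1 Ss ZS mf f1 fs; apply/cvgrPdist_le => e e0.
(* One radius serves all values of [S]: it is the minimum of finitely many radii. *)
have [D D0 fD] : exists2 D, 0 < D & forall a, a \in s -> forall y,
    `|y - a| < D -> `|f y - f a| <= e / 2.
  elim: s fs {Ss} => [|a s IHs] fs; first by exists 1.
  have [|D D0 fD] := IHs; first by move=> b bs; apply: fs; rewrite inE bs orbT.
  have /cvgrPdist_le /(_ (e / 2)) := fs _ (mem_head a s).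
  move=> /(_ (divr_gt0 e0 (ltr0n _ 2)))/nbhs_ballP[D' /= D'0 fD'].
  exists (Num.min D D'); first by rewrite lt_min D0.
  move=> b; rewrite inE => /orP[/eqP -> y|bs y]; rewrite lt_min => /andP[yD yD'].
    by rewrite distrC; apply: fD'; rewrite /ball/= distrC.
  exact: fD.
have bZ n : bounded_mfun (Z n) by split => //; exists 1.
have bS : bounded_mfun S by split => //; exists 1.
have bfZ n : bounded_mfun (fun w => f (Z n w)).
  by split; [exact: measurableT_comp|exists 1 => w; exact: f1].
have bfS : bounded_mfun (fun w => f (S w)).
  by split; [exact: measurableT_comp|exists 1 => w; exact: f1].
have bZS n : bounded_mfun (fun w => (Z n w - S w) ^+ 2).
  exact/bounded_mfunX/bounded_mfunB.
(* A second moment below this threshold contributes at most e/2 after multiplication by 2 / D^2. *)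
have D20 : 0 < e * D ^+ 2 / 4 by rewrite divr_gt0// mulr_gt0// exprn_gt0.
near=> n.
rewrite -bounded_RintegralB//.
apply: (le_trans (bounded_le_norm_Rintegral _ _)); first exact: bounded_mfunB.
apply: (@le_trans _ _ (\int[P]_w (e / 2 + 2 / D ^+ 2 * (Z n w - S w) ^+ 2))).
  apply: bounded_le_Rintegral; first exact/bounded_mfun_norm/bounded_mfunB.
    exact/bounded_mfunD/bounded_mfunZ/bZS/bounded_mfun_cst.
  move=> w; have [ZD|ZD] := ltP `|Z n w - S w| D.
    rewrite distrC; apply: (le_trans (fD _ (Ss w) _ ZD)).
    by rewrite lerDl mulr_ge0// ?sqr_ge0// divr_ge0// ?sqr_ge0.
  apply: (@le_trans _ _ 2).
    by rewrite (le_trans (ler_normB _ _))// -[leRHS]/(1 + 1) lerD// f1.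
  apply: ler_wpDl; first by rewrite divr_ge0 ?ltW.
  rewrite mulrAC ler_pdivlMr ?exprn_gt0// ler_pM2l//.
  by rewrite -[leRHS]ger0_norm ?sqr_ge0// normrX ler_pXn2r// ?nnegrE ?ltW.
rewrite bounded_RintegralD; [|exact: bounded_mfun_cst|exact: bounded_mfunZ].
rewrite (bounded_RintegralZ _ _ (bZS n)).
rewrite Rintegral_probability_cst.
have : `|0 - \int[P]_w (Z n w - S w) ^+ 2| <= e * D ^+ 2 / 4.
  by near: n; move/cvgrPdist_le : ZS; exact.
rewrite sub0r normrN => /(le_trans (ler_norm _)) ZSn.
rewrite [leRHS](_ : e = e / 2 + 2 / D ^+ 2 * (e * D ^+ 2 / 4)); last first.
  by field; rewrite gt_eqF.
by rewrite lerD2l ler_wpM2l// divr_ge0// sqr_ge0.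
Unshelve. all: by end_near. Qed.

(** For y < x, the point x and ]-oo, y] are disjoint parts of ]-oo, x], so the mass of x plus
    [cdf Z y] is at most [cdf Z x]. Letting y tend to x from the left leaves no room for a mass at
    x. *)
Lemma cdf_continuous_atom d (T : measurableType d) (R : realType)
    (P : probability T R) (Z : {RV P >-> R}) (x : R) :
  {for x, continuous (cdf Z)} -> distribution P Z [set x] = 0%E.
Proof.
move=> cZ; set A := distribution P Z [set x].
have fA : A \is a fin_num by exact: fin_num_measure.
have fc : cdf Z x \is a fin_num by exact: fin_num_measure.
have : (A + cdf Z y @[y --> x^'-] --> A + cdf Z x)%E.
  apply: cvgeD; first by rewrite fin_num_adde_defr.
    exact: cvg_cst.
  exact: cvg_at_left_filter.
move=> /cvge_to_le -/(_ (cdf Z x)) AZ.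
apply/eqP; rewrite eq_le measure_ge0 andbT -(leeD2rE _ _ fc) add0e.
apply: AZ; near=> y.
rewrite -measureU//; last first.
  apply/seteqP; split => // z [/= ->]; rewrite in_itv/= leNgt.
  by move=> /negP; apply; near: y; exact: nbhs_left_lt.
apply: le_measure; rewrite ?inE//; first exact: measurableU.
move=> z /= [->|]; rewrite !in_itv/= ?lexx// => /le_trans; apply.
by near: y; exact: nbhs_left_le.
Unshelve. all: by end_near. Qed.

Lemma continuous_even_powR (R : realType) (r : R) : 0 < r ->
  continuous (fun x : R => even_powR x r).
Proof.
move=> r0 a; rewrite /even_powR.
have [->|a0] := eqVneq a 0.
  apply/cvgrPdist_le => e e0.
  rewrite normr0 powR0 ?gt_eqF//.
  (* The power is not differentiable at 0 for small [r]; the radius e^(1/r) is explicit there. *)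
  have : \forall y \near (0 : R^o), `|y| <= e `^ r^-1.
    by apply: nbhs0_le; exact: powR_gt0.
  apply: filterS => y ye; rewrite sub0r normrN ger0_norm ?powR_ge0//.
  have -> : e = (e `^ r^-1) `^ r by rewrite -powRrM mulVf ?gt_eqF// powRr1// ltW.
  by rewrite ge0_ler_powR ?(ltW r0) ?nnegrE ?powR_ge0.
have /= := @continuous_comp R^o R^o R^o Num.norm (@powR R ^~ r) a.
apply; first exact: (@norm_continuous _ R^o).
apply/differentiable_continuous/derivable1_diffP/derivable_powR.
by rewrite in_itv/= normr_gt0 a0.
Qed.

(** Away from 0 the sign is locally constant; at 0 the function is dominated by the even power,
    which vanishes there. *)
Lemma continuous_odd_powR (R : realType) (r : R) : 0 < r ->
  continuous (fun x : R => odd_powR x r).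
Proof.
move=> r0 a; rewrite /odd_powR.
have ce := continuous_even_powR r0 (x := a).
have [a0|a0|->] := ltgtP a 0.
- rewrite /continuous_at ltr0_sg//.
  apply: (@cvg_trans _ (-1 * even_powR y r @[y --> a])).
    by apply: near_eq_cvg; apply: filterS (lt_nbhsl a0) => y y0 /=; rewrite ltr0_sg.
  exact: (cvgM (cvg_cst _) ce).
- rewrite /continuous_at gtr0_sg//.
  apply: (@cvg_trans _ (1 * even_powR y r @[y --> a])).
    by apply: near_eq_cvg; apply: filterS (lt_nbhsr a0) => y y0 /=; rewrite gtr0_sg.
  exact: (cvgM (cvg_cst _) ce).
- rewrite /continuous_at sgr0 mul0r; apply/cvgr0Pnorm_le => e e0.
  have /cvgrPdist_le /(_ _ e0) := continuous_even_powR r0 (x := 0).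
  rewrite /even_powR normr0 powR0 ?gt_eqF//; apply: filterS => y.
  rewrite sub0r normrN normrM; apply: le_trans.
  by rewrite ler_piMl// normr_sg lern1 leq_b1.
Qed.

(** * The walk and its filtration *)

Section SigmaRV.
Context d d' (T : measurableType d) (T' : measurableType d') (R : realType).
Context (P : probability T R) (f : {RV P >-> T'}).

Lemma sigma_RV_preimage (A : set T') : measurable A -> sigma_RV f (f @^-1` A).
Proof. by move=> mA; exists A => //; rewrite setTI. Qed.

Lemma sigma_RV_measurable : sigma_RV f `<=` measurable.
Proof. by move=> _ [A mA <-]; exact: measurable_funPT. Qed.

Lemma measurable_RV_preimage (A : set T') :
  measurable A -> measurable (f @^-1` A).
Proof. by move=> mA; exact/sigma_RV_measurable/sigma_RV_preimage. Qed.

Lemma sigma_RVT : sigma_RV f setT.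
Proof. by rewrite -(preimage_setT f); exact: sigma_RV_preimage. Qed.

Lemma sigma_RVI : setI_closed (sigma_RV f).
Proof.
move=> _ _ [A mA <-] [C mC <-]; exists (A `&` C); first exact: measurableI.
by rewrite !setTI.
Qed.

End SigmaRV.

Section Walk.
Context (R : realType) (d : measure_display) (T : measurableType d).
Context (P : probability T R) (p : R) (X : nat -> {RV P >-> R}).
Context (K : nat -> {RV P >-> nat}) (B : nat -> {RV P >-> bool}).

Definition sign_rv (b : bool) : R := if b then 1 else -1.

(* The steps of the walk, corrected on a null event so as to be everywhere
   equal to 1 or -1; the value at 0 is junk. *)
Fixpoint walk (n : nat) (w : T) : R :=
  match n with
  | 0 | 1 => sign_rv (X 1%N w == 1)
  | 2 => sign_rv (B 1%N w) * sign_rv (X 1%N w == 1)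
  | m.+1 => sign_rv (B m w) *
      (if K m w == 1%N then sign_rv (X 1%N w == 1)
       else if K m w == 2%N then sign_rv (B 1%N w) * sign_rv (X 1%N w == 1)
       else walk m w)
  end.

Lemma walkS n w : (2 <= n)%N ->
  walk n.+1 w = sign_rv (B n w) *
    (if K n w == 1%N then walk 1 w else if K n w == 2%N then walk 2 w
     else walk n w).
Proof. by case: n => [|[|n]]. Qed.

Lemma walk1E w : walk 1 w = sign_rv (X 1%N w == 1).
Proof. by []. Qed.

Lemma walk2E w : walk 2 w = sign_rv (B 1%N w) * walk 1 w.
Proof. by []. Qed.

Lemma norm_sign_rv b : `|sign_rv b| = 1.
Proof. by case: b; rewrite /= ?normrN normr1. Qed.

Lemma norm_walk n w : `|walk n w| = 1.
Proof.
elim: n => [|n IHn]; first exact: norm_sign_rv.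
have [n2|] := leqP 2 n; last first.
  by case: n {IHn} => [|[|//]] _; rewrite /= ?normrM !norm_sign_rv ?mulr1.
rewrite walkS// normrM norm_sign_rv mul1r.
by case: ifP => _; [|case: ifP]; rewrite //= ?normrM !norm_sign_rv ?mulr1.
Qed.

(* In [erw_sources], [None] is X_1, [inl n] is K_(n+2) and [inr n] is B_(n+1). *)
Definition source_time (i : option (nat + nat)) : nat :=
  match i with None => 0 | Some (inl n) => n.+2 | Some (inr n) => n.+1 end.

(** The strict inequality is the right one: K_n and B_n, of time n, first act on X_(n+1), so that
    X_n is determined by [past n] and independent of [present n]. *)
Definition past n : set (option (nat + nat)) := [set i | (source_time i < n)%N].
Definition present n : set (option (nat + nat)) := [set i | source_time i = n].

Notation span := (cylinder_span (erw_sources X K B)).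

Lemma erw_sources_measurable i : erw_sources X K B i `<=` measurable.
Proof. by case: i => [[n|n]|]; exact: sigma_RV_measurable. Qed.

Lemma erw_sourcesT i : erw_sources X K B i setT.
Proof. by case: i => [[n|n]|]; exact: sigma_RVT. Qed.

Lemma erw_sourcesI i : setI_closed (erw_sources X K B i).
Proof. by case: i => [[n|n]|]; exact: sigma_RVI. Qed.

Local Notation spanM := (cylinder_spanM erw_sourcesT erw_sourcesI).
Local Notation span_cst := (cylinder_span_cst erw_sourcesT).
Local Notation spanD := (cylinder_spanD (F := erw_sources X K B)).
Local Notation spanB := (cylinder_spanB erw_sourcesT).
Local Notation spanZ := (cylinder_spanZ erw_sourcesT).
Local Notation span_bounded := (cylinder_span_bounded erw_sources_measurable).

Lemma sign_rvE (A : set T) w : sign_rv (w \in A) = 2 * \1_A w - 1.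
Proof. by rewrite indicE; case: (w \in A) => /=; ring. Qed.

Lemma span_sign_rv i (A : set T) : erw_sources X K B i A ->
  span [set i] (fun w => sign_rv (w \in A)).
Proof.
move=> FA; under eq_fun do rewrite sign_rvE.
apply: spanB; last exact: span_cst.
exact/spanZ/cylinder_span_indic/(cylinder1 erw_sourcesT).
Qed.

Lemma signBE n w : sign_rv (B n w) = sign_rv (w \in B n @^-1` [set true]).
Proof. by congr sign_rv; apply/idP/idP => [Bw|]; rewrite ?inE. Qed.

Lemma span_signB n : span [set Some (inr n)] (fun w => sign_rv (B n.+1 w)).
Proof.
under eq_fun do rewrite signBE.
by apply: span_sign_rv; exact: sigma_RV_preimage.
Qed.

Lemma signX1E w : sign_rv (X 1%N w == 1) = sign_rv (w \in X 1%N @^-1` [set 1]).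
Proof. by congr sign_rv; apply/eqP/idP => [Xw|]; rewrite ?inE. Qed.

Lemma span_signX1 : span [set None] (fun w => sign_rv (X 1%N w == 1)).
Proof.
under eq_fun do rewrite signX1E.
by apply: span_sign_rv; exact: sigma_RV_preimage.
Qed.

Lemma span_indicK n k :
  span [set Some (inl n)] (\1_(K n.+2 @^-1` [set k]) : T -> R).
Proof.
apply/cylinder_span_indic/(cylinder1 erw_sourcesT).
exact: sigma_RV_preimage.
Qed.

(** A polynomial form of the recursion, suited to the span. The last weight is a complement and not
    the indicator of K_n = n, so that the identity holds everywhere, even where K_n leaves its
    support. *)
Lemma walkSE n w : (2 <= n)%N ->
  walk n.+1 w = sign_rv (B n w) *
    (\1_(K n @^-1` [set 1%N]) w * walk 1 w
     + \1_(K n @^-1` [set 2%N]) w * walk 2 w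
     + (1 - \1_(K n @^-1` [set 1%N]) w - \1_(K n @^-1` [set 2%N]) w) * walk n w).
Proof.
move=> n2; rewrite walkS// !indicE; congr (_ * _).
have E k : (w \in K n @^-1` [set k]) = (K n w == k).
  by apply/idP/eqP; rewrite inE.
rewrite !E; case: eqP => [->|_] /=; first by ring.
by case: eqP => _ /=; ring.
Qed.

Lemma subset_past n m : (n <= m)%N -> past n `<=` past m.
Proof. by move=> nm i /= /leq_trans; exact. Qed.

Lemma span_walk1 : span (past 1) (walk 1).
Proof. by apply: subset_cylinder_span span_signX1 => _ ->. Qed.

Lemma span_walk2 : span (past 2) (walk 2).
Proof.
rewrite (funext walk2E); apply: spanM.
  by apply: subset_cylinder_span (span_signB 0) => _ ->.
exact: subset_cylinder_span (@subset_past 1 2 isT) span_walk1.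
Qed.

Lemma span_walk n : (0 < n)%N -> span (past n) (walk n).
Proof.
elim: n => [//|[|[|n]] IHn] _; [exact: span_walk1|exact: span_walk2|].
have s1 : span (past n.+3) (walk 1).
  by apply: subset_cylinder_span span_walk1; exact: subset_past.
have s2 : span (past n.+3) (walk 2).
  by apply: subset_cylinder_span span_walk2; exact: subset_past.
have sn : span (past n.+3) (walk n.+2).
  by apply: subset_cylinder_span (IHn isT); exact: subset_past.
have sB : span (past n.+3) (fun w => sign_rv (B n.+2 w)).
  by apply: subset_cylinder_span (span_signB _) => _ ->; exact: leqnn.
have sK k : span (past n.+3) (\1_(K n.+2 @^-1` [set k]) : T -> R).
  by apply: subset_cylinder_span (span_indicK _ _) => _ ->; exact: leqnn.
rewrite (funext (fun w => @walkSE n.+2 w isT)).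
apply: (spanM sB); apply: spanD; first apply: spanD.
- exact: spanM.
- exact: spanM.
- exact/spanM/sn/spanB/sK/spanB/sK/span_cst.
Qed.

Lemma bounded_walk n : bounded_mfun (walk n).
Proof.
case: n => [|n]; first exact: (span_bounded span_walk1).
exact: span_bounded (span_walk _).
Qed.

(** * Centred choices and uncorrelated increments *)

Hypothesis hX : is_erw_12n p X K B.

Local Notation indep := (cylinder_span_indep erw_sources_measurable
  erw_sourcesT erw_sourcesI (erw_indep hX)).

(** The mean 2p - 1 of a sign times the probability 1/3 of each remembered time. *)
Let a : R := (2 * p - 1) / 3.

Lemma Rintegral_signB n : \int[P]_w sign_rv (B n.+1 w) = 2 * p - 1.
Proof.
have mB : measurable (B n.+1 @^-1` [set true]).
  exact: measurable_RV_preimage.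
have bB := bounded_mfun_indic R mB.
under eq_Rintegral do rewrite signBE sign_rvE.
rewrite bounded_RintegralB; [|exact: bounded_mfunZ|exact: bounded_mfun_cst].
rewrite bounded_RintegralZ// Rintegral_probability_cst Rintegral_indic//.
by rewrite (erw_sign hX).
Qed.

Lemma Rintegral_indicK n k : k \in [:: 1; 2]%N ->
  \int[P]_w (\1_(K n.+3 @^-1` [set k]) w : R) = 3^-1.
Proof.
move=> k12; rewrite Rintegral_indic; last first.
  exact: measurable_RV_preimage.
by rewrite (erw_index hX)// in_cons; move: k12; rewrite !inE => /orP[]->; rewrite ?orbT.
Qed.

Lemma span_present_signB n :
  span (present n.+1) (fun w => sign_rv (B n.+1 w)).
Proof. by apply: subset_cylinder_span (span_signB n) => _ ->. Qed.

Lemma span_present_signBK n k : span (present n.+2)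
  (fun w => sign_rv (B n.+2 w) * \1_(K n.+2 @^-1` [set k]) w).
Proof.
apply: spanM; first exact: span_present_signB.
by apply: subset_cylinder_span (span_indicK n k) => _ ->.
Qed.

Lemma Rintegral_signBK n k : k \in [:: 1; 2]%N ->
  \int[P]_w (sign_rv (B n.+3 w) * \1_(K n.+3 @^-1` [set k]) w) = a.
Proof.
move=> k12; rewrite (indep _ (span_signB n.+2) (span_indicK n.+1 k)); last first.
  by apply/seteqP; split => // i [/= ->].
by rewrite Rintegral_signB Rintegral_indicK.
Qed.

Lemma past_present_uncorrelated n f g : span (past n) f ->
  span (present n) g -> \int[P]_w g w = 0 -> \int[P]_w (f w * g w) = 0.
Proof.
move=> sf sg g0; rewrite (indep _ sf sg) ?g0 ?mulr0//.
by apply/seteqP; split => // i []; rewrite /past /present /= => + ni; rewrite ni ltnn.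
Qed.

(** By [walkSE] the increment is a combination of X_1, X_2 and X_n whose coefficients are centred
    functions of K_n and B_n, hence independent of the past. The bound on [n] excludes K_2, which is
    uniform on two values only. *)
Lemma walk_increment_uncorrelated n f : (3 <= n)%N -> span (past n) f ->
  \int[P]_w (f w * (walk n.+1 w - a * (walk 1 w + walk 2 w + walk n w))) = 0.
Proof.
case: n => [|[|[|n]]]// _ sf.
pose h k w := sign_rv (B n.+3 w) * \1_(K n.+3 @^-1` [set k]) w : R.
have sh k : span (present n.+3) (h k) by exact: span_present_signBK.
have bh k : bounded_mfun (h k) by exact: span_bounded (sh k).
have sB : span (present n.+3) (fun w => sign_rv (B n.+3 w)).
  exact: span_present_signB.
have bB := span_bounded sB.
have sa : span (present n.+3) (fun=> a) by exact: span_cst.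
have ba : bounded_mfun (fun _ : T => a) by exact: bounded_mfun_cst.
have fwalk k : (0 < k <= n.+3)%N -> span (past n.+3) (fun w => f w * walk k w).
  move=> /andP[k0 kn]; apply: (spanM sf).
  by apply: subset_cylinder_span (span_walk k0); exact: subset_past.
have term k g : (0 < k <= n.+3)%N -> span (present n.+3) g ->
    \int[P]_w g w = 0 ->
    \int[P]_w (f w * walk k w * g w) = 0 /\
    bounded_mfun (fun w => f w * walk k w * g w).
  move=> kn sg g0; split; first exact: past_present_uncorrelated (fwalk _ kn) sg g0.
  by apply: bounded_mfunM; [exact: span_bounded (fwalk _ kn)|exact: span_bounded sg].
have [|||t1 b1] := term 1%N (fun w => h 1%N w - a) => //.
- exact: spanB.
- rewrite bounded_RintegralB// Rintegral_probability_cst.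
  by rewrite Rintegral_signBK// subrr.
have [|||t2 b2] := term 2%N (fun w => h 2%N w - a) => //.
- exact: spanB.
- rewrite bounded_RintegralB// Rintegral_probability_cst.
  by rewrite Rintegral_signBK// subrr.
(* This coefficient is centred because (2p - 1) - 2a = a. *)
have [|||t3 b3] := term n.+3 (fun w => sign_rv (B n.+3 w) - h 1%N w - h 2%N w - a).
- by rewrite leqnn.
- exact/spanB/sa/spanB/sh/spanB/sh/sB.
- rewrite !bounded_RintegralB//;
    try by [exact: bounded_mfunB|exact/bounded_mfunB/bh/bounded_mfunB].
  rewrite Rintegral_probability_cst !Rintegral_signBK// Rintegral_signB.
  by rewrite /a; field.
under eq_Rintegral.
  move=> w _; rewrite walkSE// (_ : f w * _ =
    f w * walk 1 w * (h 1%N w - a) + f w * walk 2 w * (h 2%N w - a)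
    + f w * walk n.+3 w * (sign_rv (B n.+3 w) - h 1%N w - h 2%N w - a)).
    over.
  by rewrite /h; ring.
rewrite bounded_RintegralD//; last exact: bounded_mfunD.
by rewrite bounded_RintegralD// t1 t2 t3 !addr0.
Qed.

End Walk.

Arguments walk : simpl never.

(** * Second moment estimate *)

Lemma ae_probability1 d (T : measurableType d) (R : realType)
    (P : probability T R) (A : set T) :
  measurable A -> P A = 1%E -> {ae P, forall w, A w}.
Proof.
move=> mA PA; apply/negligibleP; first exact: measurableC.
by rewrite [LHS]probability_setC// PA subee.
Qed.

Lemma probability_setU_disjoint d (T : measurableType d) (R : realType)
    (P : probability T R) (A C : set T) :
  measurable A -> measurable C -> A `&` C = set0 ->
  P (A `|` C) = (P A + P C)%E.
Proof. exact: measureU. Qed.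

Section WalkLimit.
Context (R : realType) (d : measure_display) (T : measurableType d).
Context (P : probability T R) (p : R) (X : nat -> {RV P >-> R}).
Context (K : nat -> {RV P >-> nat}) (B : nat -> {RV P >-> bool}).

Local Notation walk := (walk X K B).

Definition walk_limit (w : T) : R :=
  erw_limit_value p * ((walk 1 w + walk 2 w) / 2).

Definition walk_mean (n : nat) (w : T) : R :=
  (\sum_(1 <= k < n.+1) walk k w) / n%:R.

Lemma bounded_walk_limit : bounded_mfun walk_limit.
Proof.
apply: bounded_mfunZ; under eq_fun do rewrite mulrC.
by apply/bounded_mfunZ/bounded_mfunD; exact: bounded_walk.
Qed.

Lemma bounded_walk_mean n : bounded_mfun (walk_mean n).
Proof.
rewrite /walk_mean; under eq_fun do rewrite mulrC; apply: bounded_mfunZ.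
elim: n => [|n IHn].
  by under eq_fun do rewrite big_geq//; exact: bounded_mfun_cst.
under eq_fun do rewrite big_nat_recr//=.
exact/bounded_mfunD/bounded_walk.
Qed.

Lemma norm_walk_mean n w : `|walk_mean n w| <= 1.
Proof.
rewrite /walk_mean; case: n => [|n]; first by rewrite invr0 mulr0 normr0.
rewrite normrM [X in _ * X]ger0_norm ?invr_ge0// ler_pdivrMr ?ltr0n// mul1r.
apply: (le_trans (ler_norm_sum _ _ _)).
under eq_bigr do rewrite norm_walk.
by rewrite sumr_const_nat subn1.
Qed.

(** (X_1 + X_2) / 2 is X_1 when the second step repeats the first, and 0 when it reverses it. *)
Lemma walk_limit_mem w :
  walk_limit w \in [:: erw_limit_value p; 0; - erw_limit_value p].
Proof.
rewrite /walk_limit walk2E walk1E /sign_rv !inE; apply/or3P.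
case: (B 1%N w); case: (X 1%N w == 1).
- by constructor 1; apply/eqP => /=; field.
- by constructor 3; apply/eqP => /=; field.
- by constructor 2; apply/eqP => /=; field.
- by constructor 2; apply/eqP => /=; field.
Qed.

HB.instance Definition _ :=
  isMeasurableFun.Build _ _ _ _ walk_limit bounded_walk_limit.1.

Hypotheses (hp0 : 0 < p) (hp1 : p < 1) (hX : is_erw_12n p X K B).

Lemma norm_erw_limit_value : `|erw_limit_value p| <= 1.
Proof.
have p0 := hp0; have p1 := hp1; have p2 : 0 < 2 - p by lra.
rewrite /erw_limit_value normrM normfV (gtr0_norm p2) ler_pdivrMr// ler_norml.
by apply/andP; split; lra.
Qed.

Lemma norm_walk_limit w : `|walk_limit w| <= 1.
Proof.
have := walk_limit_mem w; rewrite !inE => /or3P[]/eqP->;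
by rewrite ?normrN ?normr0 ?norm_erw_limit_value.
Qed.

Let a : R := (2 * p - 1) / 3.

Lemma drift_itv : - 3^-1 <= a <= 3^-1.
Proof. by have p0 := hp0; have p1 := hp1; rewrite /a; apply/andP; split; lra. Qed.

(* [walk_martingale] has the increments X_(n+1) - a (X_1 + X_2 + X_n), and its
   distance to (1 - a) (S_n - n S) is bounded. *)
Definition walk_deviation (n : nat) (w : T) : R :=
  \sum_(1 <= k < n.+1) (walk k w - walk_limit w).

Definition walk_martingale (n : nat) (w : T) : R :=
  (1 - a) * walk_deviation n w + a * (walk n w - walk_limit w).

(** The difference is X_(n+1) - a X_n - (1 - a) S, and (1 - a) S = a (X_1 + X_2) because 1 - a = 2
    (2 - p) / 3. This identity dictates the value of S. *)
Lemma walk_martingaleS n w : walk_martingale n.+1 w =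
  walk_martingale n w + (walk n.+1 w - a * (walk 1 w + walk 2 w + walk n w)).
Proof.
have p1 := hp1; rewrite /walk_martingale /walk_deviation big_nat_recr//=.
move: (\sum_(_ <= _ < _) _) (walk n.+1 w) (walk n w) => U y z.
by rewrite /walk_limit /erw_limit_value /a; field; rewrite gt_eqF//; lra.
Qed.

Local Notation span := (cylinder_span (erw_sources X K B)).
Local Notation spanB := (cylinder_spanB (erw_sourcesT X K B)).
Local Notation spanZ := (cylinder_spanZ (erw_sourcesT X K B)).

Lemma span_walk_le n k : (0 < k <= n)%N -> span (past n) (walk k).
Proof.
move=> /andP[k0 kn]; apply: subset_cylinder_span (span_walk X K B k0).
exact: subset_past.
Qed.

Lemma span_walk_limit n : (2 <= n)%N -> span (past n) walk_limit.
Proof.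
move=> n2; apply: spanZ; under eq_fun do rewrite mulrC.
by apply/spanZ/cylinder_spanD; apply: span_walk_le => //; exact: ltnW.
Qed.

Lemma span_walk_deviation n m : (2 <= m)%N -> (n <= m)%N ->
  span (past m) (walk_deviation n).
Proof.
move=> m2; rewrite /walk_deviation; elim: n => [_|n IHn nm].
  by under eq_fun do rewrite big_geq//; apply: cylinder_span_cst; exact: erw_sourcesT.
under eq_fun do rewrite big_nat_recr//=.
apply: cylinder_spanD; first exact/IHn/ltnW.
by apply: spanB; [exact: span_walk_le|exact: span_walk_limit].
Qed.

Lemma span_walk_martingale n : (2 <= n)%N -> span (past n) (walk_martingale n).
Proof.
move=> n2; apply: cylinder_spanD; first exact/spanZ/span_walk_deviation.
apply/spanZ/spanB; last exact: span_walk_limit.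
by apply: span_walk_le; rewrite leqnn andbT ltnW.
Qed.

Lemma bounded_walk_martingale n : bounded_mfun (walk_martingale n).
Proof.
apply: bounded_mfunD; last first.
  exact/bounded_mfunZ/bounded_mfunB/bounded_walk_limit/bounded_walk.
apply: bounded_mfunZ; rewrite /walk_deviation; elim: n => [|n IHn].
  by under eq_fun do rewrite big_geq//; exact: bounded_mfun_cst.
under eq_fun do rewrite big_nat_recr//=.
exact/bounded_mfunD/bounded_mfunB/bounded_walk_limit/bounded_walk.
Qed.

(** The cross term vanishes by [walk_increment_uncorrelated], so each step adds only the second
    moment of an increment. *)
Lemma walk_martingale_moment2 n : (3 <= n)%N ->
  \int[P]_w walk_martingale n w ^+ 2 <=
  \int[P]_w walk_martingale 3 w ^+ 2 + 4 * n%:R.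
Proof.
elim: n => // n IHn; rewrite leq_eqVlt => /predU1P[<-|n3].
  by rewrite lerDl mulr_ge0.
pose xi w := walk n.+1 w - a * (walk 1 w + walk 2 w + walk n w).
have bM := bounded_walk_martingale n.
have bxi : bounded_mfun xi.
  apply: bounded_mfunB; first exact: bounded_walk.
  by apply/bounded_mfunZ/bounded_mfunD/bounded_walk/bounded_mfunD; exact: bounded_walk.
have bMxi := bounded_mfunM bM bxi.
(* An increment is at most 1 + 3 |a| in absolute value, and |a| <= 1/3. *)
have xi2 w : xi w ^+ 2 <= 4.
  have : `|xi w| <= 2.
    apply: (le_trans (ler_normB _ _)); rewrite norm_walk normrM.
    have s3 : `|walk 1 w + walk 2 w + walk n w| <= 3.
      have := ler_normD (walk 1 w + walk 2 w) (walk n w).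
      have := ler_normD (walk 1 w) (walk 2 w); rewrite !norm_walk; lra.
    have a3 : `|a| <= 3^-1 by rewrite ler_norml; exact: drift_itv.
    have := ler_pM (normr_ge0 _) (normr_ge0 _) a3 s3; lra.
  rewrite ler_norml; nra.
have orth : \int[P]_w (walk_martingale n w * xi w) = 0.
  apply: (walk_increment_uncorrelated hX) => //.
  exact/span_walk_martingale/ltnW.
under eq_Rintegral do rewrite walk_martingaleS -/(xi _) sqrrD -mulr_natl.
rewrite !bounded_RintegralD ?bounded_RintegralZ// ?orth.
- rewrite mulr0 addr0 -[n.+1]addn1 natrD mulrDr mulr1 addrA.
  apply: lerD; first exact: IHn.
  apply: (@le_trans _ _ (\int[P]_w 4)); last by rewrite Rintegral_probability_cst.
  by apply: bounded_le_Rintegral => //; [exact: bounded_mfunX|exact: bounded_mfun_cst].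
- exact: bounded_mfunX.
- exact: bounded_mfunZ.
- by apply: bounded_mfunD; [exact: bounded_mfunX|exact: bounded_mfunZ].
- exact: bounded_mfunX.
Qed.

Lemma walk_mean_subE n w : (0 < n)%N ->
  walk_mean n w - walk_limit w = walk_deviation n w / n%:R.
Proof.
move=> n0; rewrite /walk_deviation sumrB sumr_const_nat subn1 /=.
by rewrite mulrBl -[walk_limit w *+ n]mulr_natr mulfK// pnatr_eq0 -lt0n.
Qed.

Lemma walk_deviation_sqr_le n w :
  walk_deviation n w ^+ 2 <= 5 * walk_martingale n w ^+ 2 + 3.
Proof.
have : `|walk n w - walk_limit w| <= 2.
  by rewrite (le_trans (ler_normB _ _))// norm_walk -[leRHS]/(1 + 1) lerD2l
    norm_walk_limit.
rewrite /walk_martingale ler_norml.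
move: (walk_deviation n w) (walk n w - walk_limit w) => U D D2.
have a3 := drift_itv.
have e2 : (a * D) ^+ 2 <= 4 / 9.
  have : `|a * D| <= 2 / 3.
    have a3' : `|a| <= 3^-1 by rewrite ler_norml.
    have D2' : `|D| <= 2 by rewrite ler_norml.
    by rewrite normrM; have := ler_pM (normr_ge0 a) (normr_ge0 D) a3' D2'; lra.
  rewrite ler_norml; nra.
move: (a * D) e2 => e e2.
(* The factor 1 - a is at least 2/3. *)
have : U ^+ 2 <= 9 / 4 * ((1 - a) * U) ^+ 2.
  have : 0 <= U ^+ 2 by exact: sqr_ge0.
  have : 4 / 9 <= (1 - a) ^+ 2 by nra.
  by rewrite exprMn; nra.
move: ((1 - a) * U) => V.
(* With M = V + e this square says V^2 <= 2 M^2 + 2 e^2, whence U^2 <= 9/2 M^2 + 2; the stated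
   constants are rounded up. *)
have := sqr_ge0 (V + 2 * e); nra.
Qed.

Lemma cvg_walk_mean_moment2 :
  \int[P]_w (walk_mean n w - walk_limit w) ^+ 2 @[n --> \oo] --> 0.
Proof.
pose C := \int[P]_w walk_martingale 3 w ^+ 2.
have C0 : 0 <= C by apply: Rintegral_ge0 => w _; exact: sqr_ge0.
(* The deviation has second moment at most 5 (C + 4n) + 3 <= (5C + 23) n, which is then divided by
   n^2. *)
have bound n : (3 <= n)%N ->
    \int[P]_w (walk_mean n w - walk_limit w) ^+ 2 <= (5 * C + 23) / n%:R.
  move=> n3; have n0 : (0 < n)%N by exact: ltn_trans n3.
  have n0' : 0 < n%:R :> R by rewrite ltr0n.
  have bM := bounded_mfunX 2 (bounded_walk_martingale n).
  apply: (@le_trans _ _ (\int[P]_w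
      (n%:R ^- 2 * (5 * walk_martingale n w ^+ 2 + 3)))).
    apply: bounded_le_Rintegral.
    - by apply/bounded_mfunX/bounded_mfunB/bounded_walk_limit/bounded_walk_mean.
    - by apply/bounded_mfunZ/bounded_mfunD/bounded_mfun_cst/bounded_mfunZ.
    - move=> w; rewrite walk_mean_subE// exprMn exprVn mulrC.
      by rewrite ler_wpM2l ?invr_ge0 ?sqr_ge0// walk_deviation_sqr_le.
  rewrite bounded_RintegralZ; last exact/bounded_mfunD/bounded_mfun_cst/bounded_mfunZ.
  rewrite bounded_RintegralD; [|exact: bounded_mfunZ|exact: bounded_mfun_cst].
  rewrite (bounded_RintegralZ _ _ bM) Rintegral_probability_cst.
  have := walk_martingale_moment2 n3; rewrite -/C.
  move: (\int[P]_w _) => I IC.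
  rewrite mulrC ler_pdivrMr ?exprn_gt0// expr2 mulrA divfK ?gt_eqF//.
  have : 1 <= n%:R :> R by rewrite ler1n.
  move: (n%:R : R) IC => x; nra.
apply: (@squeeze_cvgr _ _ _ _ (fun=> 0) (fun n => (5 * C + 23) / n%:R)).
- exists 3%N => // n /= n3; rewrite bound// andbT.
  by apply: Rintegral_ge0 => w _; exact: sqr_ge0.
- exact: cvg_cst.
- rewrite -[X in _ --> X](mulr0 (5 * C + 23)); apply: cvgM; first exact: cvg_cst.
  by rewrite -cvg_shiftS; exact: cvg_harmonic.
Qed.

(** The prescribed masses of X_1 and of each K_n add up to 1, so these variables stay in their
    supports off a countable union of null events. There both recursions agree by induction. *)
Lemma ae_walk : {ae P, forall w, forall n, (0 < n)%N -> walk n w = X n w}.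
Proof.
have aeX1 : {ae P, forall w, X 1%N w = sign_rv R (X 1%N w == 1)}.
  have mX c : measurable (X 1%N @^-1` [set c]) by exact: measurable_RV_preimage.
  have : {ae P, forall w, (X 1%N @^-1` [set 1] `|` X 1%N @^-1` [set -1]) w}.
    apply: ae_probability1; first exact: measurableU.
    rewrite probability_setU_disjoint//; last first.
      apply/seteqP; split => // w [/= -> e]; exfalso; lra.
    by rewrite (erw_init_pos hX) (erw_init_neg hX) -EFinD addrC subrK.
  apply: filterS => w [/= ->|/= ->]; first by rewrite eqxx.
  by rewrite /sign_rv; case: eqP => // ?; lra.
have aeK n : {ae P, forall w, (3 <= n)%N -> K n w \in [:: 1; 2; n]%N}.
  have [n3|] := boolP (3 <= n)%N; last by move=> _; apply: aeW.
  have mK k : measurable (K n @^-1` [set k]) by exact: measurable_RV_preimage.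
  have : {ae P, forall w, (K n @^-1` [set 1%N] `|` K n @^-1` [set 2%N]
     `|` K n @^-1` [set n]) w}.
    apply: ae_probability1; first by do 2 apply: measurableU => //.
    rewrite probability_setU_disjoint//; [|exact: measurableU|].
      rewrite probability_setU_disjoint//; last by apply/seteqP; split => // w [/= ->].
      rewrite !(erw_index hX)// ?inE ?eqxx ?orbT//= -!EFinD; congr EFin.
      by field.
    apply/seteqP; split => // w [[/= ->|/= ->] nE]; by rewrite -nE in n3.
  by apply: filterS => w [[|]|] /= -> _; rewrite !inE eqxx ?orbT.
have aeK2 : {ae P, forall w, K 2%N w \in [:: 1; 2]%N}.
  have mK k : measurable (K 2%N @^-1` [set k]) by exact: measurable_RV_preimage.
  have : {ae P, forall w, (K 2%N @^-1` [set 1%N] `|` K 2%N @^-1` [set 2%N]) w}.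
    apply: ae_probability1; first exact: measurableU.
    rewrite probability_setU_disjoint//; last by apply/seteqP; split => // w [/= ->].
    rewrite !(erw_index2 hX)// ?inE ?eqxx ?orbT//= -!EFinD; congr EFin.
    by field.
  by apply: filterS => w [|] /= ->; rewrite !inE eqxx ?orbT.
move/ae_foralln : aeK => aeK.
apply: filterS3 aeX1 aeK aeK2 => w X1 Kw K2.
have signE b (x : R) : sign_rv R b * x = if b then x else - x.
  by case: b; rewrite /= ?mul1r ?mulN1r.
have walk1 : walk 1 w = X 1%N w by rewrite walk1E -X1.
have walk2 : walk 2 w = X 2%N w by rewrite (erw_step2 hX) walk2E signE walk1.
elim=> // n IHn _; have [|n2] := ltnP n 2; first by case: n {IHn} => [|[|//]].
rewrite walkS// (erw_step hX)// signE.
suff -> : (if K n w == 1%N then walk 1 w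
    else if K n w == 2%N then walk 2 w else walk n w) = X (K n w) w by [].
(* For n = 2 the list reads [[:: 1; 2; 2]] and covers the two values of K_2 as well. *)
have : K n w \in [:: 1; 2; n]%N.
  move: n2; rewrite leq_eqVlt => /predU1P[<-|/Kw//].
  by move: K2; rewrite !inE => /orP[]->; rewrite ?orbT.
rewrite walk1 walk2 IHn 1?ltnW// !inE.
by do 2 case: eqP => [->//|_]; move=> /eqP->.
Qed.

End WalkLimit.

(** * Law of the limit and convergence *)

(** The indicator is locally constant on either side of [x]. *)
Lemma continuous_indic_itvNyc (R : realType) (x a : R) : a != x ->
  {for a, continuous (\1_(`]-oo, x]%classic) : R -> R)}.
Proof.
rewrite neq_lt => /orP[ax|xa]; apply: cvg_near_cst.
  apply: filterS (lt_nbhsl ax) => y yx.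
  by rewrite !indicE !mem_set//= in_itv/= ltW.
apply: filterS (lt_nbhsr xa) => y xy.
by rewrite !indicE !memNset//= in_itv/=; apply/negP; rewrite -ltNge.
Qed.

Lemma distribution_expectation d (T : measurableType d) (R : realType)
    (P : probability T R) (Y : {RV P >-> R}) (A : set R) : measurable A ->
  distribution P Y A = 'E_P[fun w => \1_A (Y w)]%E.
Proof.
move=> mA; rewrite /distribution /pushforward -expectation_indic//.
exact: measurable_RV_preimage.
Qed.

Section Convergence.
Context (R : realType) (d : measure_display) (T : measurableType d).
Context (P : probability T R) (p : R) (X : nat -> {RV P >-> R}).
Context (K : nat -> {RV P >-> nat}) (B : nat -> {RV P >-> bool}).
Hypotheses (hp0 : 0 < p) (hp1 : p < 1) (hX : is_erw_12n p X K B).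

Local Notation S := (walk_limit p X K B).
Local Notation m := (erw_limit_value p).

Lemma walk_limit_law : has_erw_limit_law p P (S : {RV P >-> R}).
Proof.
move=> A mA; rewrite distribution_expectation// !diracE.
pose x w : R := \1_(X 1%N @^-1` [set 1]) w.
pose e w : R := \1_(B 1%N @^-1` [set true]) w.
have sx : cylinder_span (erw_sources X K B) [set None] x.
  apply/cylinder_span_indic/(cylinder1 (erw_sourcesT X K B)).
  exact: sigma_RV_preimage.
have se : cylinder_span (erw_sources X K B) [set Some (inr 0%N)] e.
  apply/cylinder_span_indic/(cylinder1 (erw_sourcesT X K B)).
  exact: sigma_RV_preimage.
have bx : bounded_mfun x by apply/bounded_mfun_indic/measurable_RV_preimage.
have be : bounded_mfun e by apply/bounded_mfun_indic/measurable_RV_preimage.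
have bxe := bounded_mfunM bx be.
have Ee : \int[P]_w e w = p.
  rewrite Rintegral_indic; last exact: measurable_RV_preimage.
  by rewrite (erw_sign hX).
have Exe : \int[P]_w (x w * e w) = p * p.
  rewrite (cylinder_span_indep (erw_sources_measurable (X := X) (K := K) (B := B))
    (erw_sourcesT X K B) (erw_sourcesI (X := X) (K := K) (B := B))
    (erw_indep hX) _ sx se).
    rewrite Ee Rintegral_indic; last exact: measurable_RV_preimage.
    by rewrite (erw_init_pos hX).
  by apply/seteqP; split => // i [/= ->].
(* Interpolation over the values of the two independent indicators [x] and [e]: S is m on x e = 1,
   -m on e = 1 and x = 0, and 0 on e = 0. Only E e = p and E (x e) = p^2 then enter. *)
rewrite (_ : (fun w => \1_A (S w)) = fun w => \1_A 0 +
    ((\1_A m - \1_A (- m)) * (x w * e w) + (\1_A (- m) - \1_A 0) * e w)); last first.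
  apply/funext => w; rewrite /walk_limit walk2E walk1E signBE signX1E /x /e.
  rewrite !indicE /sign_rv.
  case: (w \in X 1%N @^-1` _); case: (w \in B 1%N @^-1` _) => /=.
  - by rewrite (_ : m * _ = m); [ring|field].
  - by rewrite (_ : m * _ = 0); [ring|field].
  - by rewrite (_ : m * _ = - m); [ring|field].
  - by rewrite (_ : m * _ = 0); [ring|field].
rewrite expectation_Rintegral; last first.
  by apply/bounded_mfunD/bounded_mfunD/bounded_mfunZ => //;
     [exact: bounded_mfun_cst|exact: bounded_mfunZ].
rewrite bounded_RintegralD; [|exact: bounded_mfun_cst|]; last first.
  by apply/bounded_mfunD/bounded_mfunZ => //; exact: bounded_mfunZ.
rewrite bounded_RintegralD; [|exact: bounded_mfunZ|exact: bounded_mfunZ].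
rewrite (bounded_RintegralZ _ _ bxe) (bounded_RintegralZ _ _ be).
rewrite Exe Ee Rintegral_probability_cst -!EFinM -!EFinD !indicE.
by congr EFin; ring.
Qed.

(** One Dirac mass has a positive weight at [a]; the others can only add to it, which also covers p
    = 1/2, where the three values coincide. *)
Lemma walk_limit_atom a : a \in [:: m; 0; - m] ->
  (0 < distribution P (S : {RV P >-> R}) [set a])%E.
Proof.
have p2 : 0 < p ^+ 2 by rewrite exprn_gt0.
have q0 : 0 < 1 - p by rewrite subr_gt0.
have pq : 0 < p * (1 - p) by rewrite mulr_gt0.
have mem1 (b : R) : (b \in [set b]) = true by apply/idP; rewrite inE.
move=> am; rewrite walk_limit_law// !diracE -!EFinM -!EFinD lte_fin.
move: am; rewrite !inE => /or3P[]/eqP->.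
- rewrite (mem1 m) mulr1 -addrA ltr_pwDl//.
  by rewrite addr_ge0// mulr_ge0// ltW.
- rewrite (mem1 0) mulr1 addrAC ltr_wpDl//.
  by rewrite addr_ge0// mulr_ge0// ltW.
- rewrite (mem1 (- m)) mulr1 ltr_wpDl//.
  by rewrite addr_ge0// mulr_ge0// ltW.
Qed.

Lemma ae_erw_mean n : {ae P, forall w, erw_mean X n w = walk_mean X K B n w}.
Proof.
apply: filterS (ae_walk hX) => w wE; congr (_ / _).
by apply: eq_big_nat => k /andP[k0 _]; rewrite wE.
Qed.

(** Expectations ignore null events, so the given walk may be replaced by the corrected one, to
    which the second moment estimate applies. *)
Lemma erw_mean_cvg_expectation (f : R -> R) : measurable_fun setT f ->
  (forall x, `|x| <= 1 -> `|f x| <= 1) ->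
  (forall a, a \in [:: m; 0; - m] -> {for a, continuous f}) ->
  'E_P[fun w => f (erw_mean X n w)]%E @[n --> \oo] --> 'E_P[fun w => f (S w)]%E.
Proof.
move=> mf f1 fc.
have bfS : bounded_mfun (fun w => f (S w)).
  split; first exact: measurableT_comp.
  by exists 1 => w; exact/f1/norm_walk_limit.
have bfZ n : bounded_mfun (fun w => f (walk_mean X K B n w)).
  split; first by apply: measurableT_comp => //; exact: (bounded_walk_mean _ _ _ _).1.
  by exists 1 => w; exact/f1/norm_walk_mean.
have fZ n : 'E_P[fun w => f (erw_mean X n w)]%E =
    (\int[P]_w f (walk_mean X K B n w))%:E.
  rewrite -expectation_Rintegral// unlock; apply: ae_eq_integral => //.
  - by apply/measurable_EFinP/measurableT_comp.
  - by apply/measurable_EFinP; case: (bfZ n).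
  - by apply: filterS (ae_erw_mean n) => w /= ->.
under eq_fun do rewrite fZ.
rewrite expectation_Rintegral//; apply: cvg_EFin; first exact: nearW.
apply: (@cvg_Rintegral_discrete_limit _ _ _ _ _ _ [:: m; 0; - m]) => //.
- by move=> n; exact: (bounded_walk_mean _ _ _ _).1.
- by move=> n w; exact: norm_walk_mean.
- by move=> w; exact: norm_walk_limit.
- by move=> w; exact: walk_limit_mem.
- exact: (cvg_walk_mean_moment2 hp0 hp1 hX).
Qed.

End Convergence.

Theorem theorem11p1 (R : realType) (p : R) (hp0 : 0 < p) (hp1 : p < 1)
    (d : measure_display) (Omega : measurableType d) (P : probability Omega R)
    (X : nat -> {RV P >-> R}) (K : nat -> {RV P >-> nat})
    (B : nat -> {RV P >-> bool}) (hX : is_erw_12n p X K B) :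
  (forall n : nat, (1 <= n)%N -> {ae P, forall w, `|erw_mean X n w| <= 1}) /\
  exists (d' : measure_display) (Omega' : measurableType d')
    (P' : probability Omega' R) (S : {RV P' >-> R}),
    [/\ has_erw_limit_law p P' S,
        cvg_in_distribution P (fun n => erw_mean X n : {mfun Omega >-> R}) P' S,
        (forall r : nat, (0 < r)%N ->
           'E_P[fun w => (erw_mean X n w ^+ r)%R]%E @[n --> \oo]
             --> 'E_P'[fun w => (S w ^+ r)%R]%E) &
        (forall r : R, 0 < r ->
           ('E_P[fun w => even_powR (erw_mean X n w) r]%E @[n --> \oo]
              --> 'E_P'[fun w => even_powR (S w) r]%E) /\
           ('E_P[fun w => odd_powR (erw_mean X n w) r]%E @[n --> \oo]
              --> 'E_P'[fun w => odd_powR (S w) r]%E))].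
Proof.
split=> [n _|].
  (* The bound is only almost sure: on a null event the given steps may take values other than 1 and
     -1. *)
  by apply: filterS (ae_erw_mean hX n) => w ->; exact: norm_walk_mean.
have powR_le1 r : 0 < r -> forall x : R, `|x| <= 1 -> `|x| `^ r <= 1.
  move=> r0 x x1; apply: (@le_trans _ _ (1 `^ r)); last by rewrite powR1.
  by rewrite ge0_ler_powR ?nnegrE ?(ltW r0).
exists d, Omega, P, (walk_limit p X K B : {RV P >-> R}); split.
- exact: walk_limit_law.
- move=> x cx; rewrite /cdf distribution_expectation//.
  under eq_fun do rewrite /cdf distribution_expectation//.
  apply: (erw_mean_cvg_expectation hp0 hp1 hX).
  + exact: measurable_indic.
  + by move=> y _; rewrite indicE ger0_norm// lern1 leq_b1.
  + move=> a am; apply: continuous_indic_itvNyc; apply: contraTneq am => ax.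
    apply/negP => /(walk_limit_atom hp0 hp1 hX).
    by rewrite ax (cdf_continuous_atom cx) ltxx.
- move=> r _; apply: (erw_mean_cvg_expectation hp0 hp1 hX (f := fun x => x ^+ r)).
  + exact: exprn_measurable.
  + by move=> x x1; rewrite normrX exprn_ile1.
  + by move=> a _; exact: exprn_continuous.
- move=> r r0; split.
  + apply: (erw_mean_cvg_expectation hp0 hp1 hX (f := fun x => even_powR x r)).
    * by apply: continuous_measurable_fun; exact: continuous_even_powR.
    * by move=> x x1; rewrite ger0_norm ?powR_ge0// powR_le1.
    * by move=> a _; exact: continuous_even_powR.
  + apply: (erw_mean_cvg_expectation hp0 hp1 hX (f := fun x => odd_powR x r)).
    * by apply: continuous_measurable_fun; exact: continuous_odd_powR.
    * move=> x x1; rewrite normrM normr_sg (ger0_norm (powR_ge0 _ _)).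
      by rewrite mulr_ile1 ?powR_ge0 ?powR_le1// lern1 leq_b1.
    * by move=> a _; exact: continuous_odd_powR.
Qed.
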